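(* Let $G$ be a connected graph. Then $\chi_{\mu_i}(G)=2$ if and only if $G$ is bipartite and $1\le \operatorname{diam}(G)\le 3$.
   Context: All graphs are finite and simple. A geodesic is a shortest path. For $X\subseteq V(G)$, two vertices $x,y\in X$ are $X$-visible if some $x,y$-geodesic has no internal vertex in $X$. $X$ is an independent mutual-visibility (IMV) set if $X$ is independent and every two vertices of $X$ are $X$-visible. $\chi_{\mu_i}(G)$ is the least $k$ such that $V(G)$ can be partitioned into $k$ IMV sets. $\operatorname{diam}(G)$ is the diameter. *)

(* Defs.v *)
From mathcomp Require Import all_boot.
Set Implicit Arguments.
Unset Strict Implicit.
Unset Printing Implicit Defensive.

Record sgraph := SGraph {
  vertex :> finType;
  adj : rel vertex;
  adj_sym : symmetric adj;
  adj_irrefl : irreflexive adj }.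

Definition connected (G : sgraph) : Prop := forall x y : G, connect (@adj G) x y.

(* As in path.v, the walk x, p_1, ..., p_n is given by its origin x and
   p = [:: p_1; ...; p_n], so that its length is size p. *)
Definition walk (G : sgraph) (x y : G) (p : seq G) : bool :=
  path (@adj G) x p && (last x p == y).

(* Equal to #|G|, a junk value, when no walk joins x to y; otherwise a shortest
   walk has length less than #|G|: see gdist_walk and gdist_min. *)
Definition gdist (G : sgraph) (x y : G) : nat :=
  find (fun n => [exists p : n.-tuple G, walk x y p]) (iota 0 #|G|).

Lemma gdist_walk (G : sgraph) (x y : G) :
  connect (@adj G) x y -> exists2 p, walk x y p & size p = gdist x y.
Proof.
case/connectP=> q0 /shortenP[q pq uq _] ->.
have lt_q : size q < #|G|.
  by rewrite -[(size q).+1]/(size (x :: q)) -(card_uniqP uq) max_card.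
have hasq : has (fun n => [exists p : n.-tuple G, walk x (last x q) p])
                (iota 0 #|G|).
  apply/hasP; exists (size q); first by rewrite mem_iota.
  by apply/existsP; exists (in_tuple q); rewrite /walk pq eqxx.
have := nth_find 0 hasq; rewrite -/(gdist x (last x q)).
rewrite nth_iota; last by rewrite -[X in _ < X](size_iota 0) -has_find.
by rewrite add0n => /existsP[p wp]; exists p => //; rewrite size_tuple.
Qed.

Lemma gdist_min (G : sgraph) (x y : G) (p : seq G) :
  walk x y p -> gdist x y <= size p.
Proof.
move=> wp; rewrite leqNgt; apply/negP => lt_p.
have := before_find 0 lt_p; rewrite nth_iota; last first.
  by apply: leq_trans lt_p _; rewrite -[X in _ <= X](size_iota 0) find_size.
by rewrite add0n => /existsP[]; exists (in_tuple p).
Qed.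

Definition geodesic (G : sgraph) (x y : G) (p : seq G) : bool :=
  walk x y p && (size p == gdist x y).

(* belast x p drops the final vertex of the walk x :: p, behead its origin. *)
Definition internal (G : sgraph) (x : G) (p : seq G) : seq G :=
  behead (belast x p).

Definition diam (G : sgraph) : nat := \max_(x : G) \max_(y : G) gdist x y.

Definition independent (G : sgraph) (X : {set G}) : bool :=
  [forall x in X, forall y in X, ~~ adj x y].

Definition bipartite (G : sgraph) : Prop :=
  exists A : {set G}, independent A /\ independent (~: A).

(* The tuple length only makes the quantifier finite: every x,y-geodesic has
   length gdist x y; see visibleP. *)
Definition visible (G : sgraph) (X : {set G}) (x y : G) : bool :=
  [exists p : (gdist x y).-tuple G,
     geodesic x y p && all (fun z => z \notin X) (internal x p)].

Lemma visibleP (G : sgraph) (X : {set G}) (x y : G) :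
  reflect (exists2 p, geodesic x y p & {in internal x p, forall z, z \notin X})
          (visible X x y).
Proof.
apply: (iffP existsP) => [[p /andP[gp /allP Xp]] | [p gp /allP Xp]].
  by exists p.
have /eqP sp : size p == gdist x y by case/andP: gp.
by exists (tcast sp (in_tuple p)); rewrite val_tcast gp.
Qed.

Definition imv (G : sgraph) (X : {set G}) : bool :=
  independent X && [forall x in X, forall y in X, visible X x y].

Definition imv_partition (G : sgraph) (P : {set {set G}}) : bool :=
  partition P [set: G] && [forall X in P, imv X].

Lemma imv_set1 (G : sgraph) (x : G) : imv [set x].
Proof.
have w0 : walk x x [::] by rewrite /walk /= eqxx.
apply/andP; split; apply/forall_inP => y /set1P ->;
  apply/forall_inP => z /set1P ->; first by rewrite adj_irrefl.
apply/visibleP; exists [::] => //.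
by rewrite /geodesic w0 eq_sym -leqn0 (gdist_min w0).
Qed.

Lemma ex_imv_partition (G : sgraph) :
  exists k, [exists P : {set {set G}}, imv_partition P && (#|P| == k)].
Proof.
exists #|preim_partition (@id G) [set: G]|; apply/existsP.
exists (preim_partition (@id G) [set: G]); rewrite eqxx andbT.
rewrite /imv_partition preim_partitionP /=.
apply/forall_inP => _ /imsetP[x _ ->].
suff -> : [set y in [set: G] | x == y] = [set x] by apply: imv_set1.
by apply/setP => y; rewrite !inE eq_sym.
Qed.

Definition chi_imv (G : sgraph) : nat := ex_minn (ex_imv_partition G).

(* Main.v *)
(* In a bipartite graph membership in a part alternates along every walk. So a
   geodesic between two vertices of a part X avoids X inside if and only if its
   length is at most 2, and X is IMV if and only if any two of its vertices are
   at distance at most 2. Stepping to a neighbour, this bounds the diameter by 3;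
   conversely, by parity, a distance at most 3 inside a part is at most 2. *)
Require Import Defs.
From mathcomp Require Import all_boot.

Set Implicit Arguments.
Unset Strict Implicit.
Unset Printing Implicit Defensive.

Lemma independentP (G : sgraph) (X : {set G}) :
  reflect {in X &, forall x y, ~~ adj x y} (independent X).
Proof.
apply: (iffP forall_inP) => [iX x y xX yX | iX x xX].
  by apply: (forall_inP (iX x xX)).
by apply/forall_inP => y yX; apply: iX.
Qed.

(** Keeps the part [A] explicit, where [bipartite] hides it under an existential. Either part may be
    empty here. *)
Definition bipartition (G : sgraph) (A : {set G}) : bool :=
  independent A && independent (~: A).

Lemma bipartition_setC (G : sgraph) (A : {set G}) :
  bipartition (~: A) = bipartition A.
Proof. by rewrite /bipartition setCK andbC. Qed.

Lemma bipartition_adj (G : sgraph) (A : {set G}) (x y : G) :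
  bipartition A -> adj x y -> (y \in A) = (x \notin A).
Proof.
case/andP=> /independentP iA /independentP iC xy.
case: (boolP (x \in A)) (boolP (y \in A)) => [xA|xA] [yA|yA] //.
  by have := iA x y xA yA; rewrite xy.
by have := iC x y; rewrite !inE xA yA xy => /(_ isT isT).
Qed.

Lemma bipartition_walk (G : sgraph) (A : {set G}) (x y : G) (p : seq G) :
  bipartition A -> walk x y p -> (y \in A) = (x \in A) (+) odd (size p).
Proof.
move=> bA; elim: p x => [|z p IHp] x; rewrite /walk /=.
  by move/eqP->; rewrite addbF.
case/andP=> /andP[xz pz] ly; rewrite (IHp z) ?/walk ?pz //.
by rewrite (bipartition_adj bA xz) addNb addbN.
Qed.

Lemma imv_independent (G : sgraph) (X : {set G}) : imv X -> independent X.
Proof. by case/andP. Qed.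

Lemma imv_gdist_le2 (G : sgraph) (X : {set G}) (x y : G) :
  bipartition X -> imv X -> x \in X -> y \in X -> gdist x y <= 2.
Proof.
move=> bX /andP[_ /forall_inP vX] xX yX.
have /visibleP[p /andP[wp /eqP <-] pX] := forall_inP (vX x xX) y yX.
(* From length 3 on, [b] is an internal vertex two steps away from [x], hence back in [X], which
   visibility forbids. *)
case: p wp pX => [|a [|b [|c p]]] //= /andP[/and3P[xa ab _] _] pX.
have := pX b; rewrite /internal /= !inE eqxx orbT => /(_ isT).
by rewrite (bipartition_adj bX ab) (bipartition_adj bX xa) xX.
Qed.

Lemma bipartition_imv (G : sgraph) (A : {set G}) :
  connected G -> bipartition A ->
  {in A &, forall x y, gdist x y <= 3} -> imv A.
Proof.
move=> cG bA dA; rewrite /imv; have /andP[-> _] := bA.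
apply/forall_inP => x xA; apply/forall_inP => y yA.
have [p wp sp] := gdist_walk (cG x y).
apply/visibleP; exists p; first by rewrite /geodesic wp sp /=.
have := dA x y xA yA; rewrite -sp.
have := bipartition_walk bA wp; rewrite xA yA.
(* Parity excludes lengths 1 and 3, the bound excludes 4 and more. At length 2 the only internal
   vertex is [a], a neighbour of [x], so outside [A]. *)
case: p wp {sp} => [|a [|b [|c [|d p]]]] //= /andP[/andP[xa _] _] _ _ z.
by rewrite /internal /= inE => /eqP->; rewrite (bipartition_adj bA xa) xA.
Qed.

Lemma diamP (G : sgraph) (n : nat) :
  reflect (forall x y : G, gdist x y <= n) (diam G <= n).
Proof.
apply: (iffP (bigmax_leqP _ _ _)) => [d x y | d x _].
  by apply: (elimT (bigmax_leqP _ _ _) (d x isT)).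
by apply/bigmax_leqP => y _.
Qed.

Lemma gdist_eq0 (G : sgraph) (x y : G) :
  connected G -> (gdist x y == 0) = (x == y).
Proof.
move=> cG; apply/eqP/eqP => [d0 | ->].
  have [p /andP[_ /eqP lp]] := gdist_walk (cG x y); rewrite d0 => /size0nil p0.
  by rewrite -lp p0.
by apply/eqP; rewrite -leqn0 (@gdist_min G y y [::]) // /walk /=.
Qed.

Lemma diam_gt0 (G : sgraph) (x y : G) :
  connected G -> x != y -> 0 < diam G.
Proof.
move=> cG; rewrite -(gdist_eq0 _ _ cG) -!lt0n => d_gt0.
by rewrite ltnNge; apply/negP => /diamP /(_ x y); rewrite leqNgt d_gt0.
Qed.

Lemma connected_neighbour (G : sgraph) (x y : G) :
  connected G -> x != y -> exists z, adj x z.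
Proof.
move=> cG; have /connectP[[|z p] /= pp ->] := cG x y; first by rewrite eqxx.
by move=> _; exists z; case/andP: pp.
Qed.

Lemma diam_gt0_adj (G : sgraph) :
  connected G -> 0 < diam G -> exists x y : G, adj x y.
Proof.
move=> cG; case: (pickP (fun u : G * G => u.1 != u.2)) => [[x y] /= xy _ | eqG].
  by exists x; apply: connected_neighbour xy.
(* Without two distinct vertices every distance is 0, contradicting the positive diameter; this also
   covers the empty graph. *)
rewrite ltnNge => /negP[]; apply/diamP => x y.
by rewrite leqn0 (gdist_eq0 _ _ cG); apply: negbFE (eqG (x, y)).
Qed.

Lemma imv_partition_setC (G : sgraph) (P : {set {set G}}) :
  imv_partition P -> #|P| = 2 ->
  exists2 A : {set G}, A != set0 /\ ~: A != set0 & imv A /\ imv (~: A).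
Proof.
case/andP=> /and3P[/eqP covP /trivIsetP tP P0] /forall_inP iP.
move/eqP/cards2P=> [A [B [AB defP]]].
have [AP BP] : A \in P /\ B \in P by rewrite defP !inE !eqxx orbT.
(* Disjointness of the blocks gives one inclusion, covering of all vertices the other. *)
have defB : B = ~: A.
  apply/eqP; rewrite eqEsubset -disjoints_subset tP 1?eq_sym //=.
  apply/subsetP => x; rewrite inE => xA; have := in_setT x.
  rewrite -covP => /bigcupP[C]; rewrite defP !inE.
  by case/orP=> /eqP-> //; rewrite (negPf xA).
exists A; rewrite -defB; last by split; apply: iP.
by split; apply: contraNneq P0 => <-.
Qed.

(** Nonemptiness serves twice: a partition has no empty block, and [A = ~: A] would force [A] to be
    empty, so there really are two blocks. *)
Lemma imv_setC_partition (G : sgraph) (A : {set G}) :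
  A != set0 -> ~: A != set0 -> imv A -> imv (~: A) ->
  imv_partition [set A; ~: A] /\ #|[set A; ~: A]| = 2.
Proof.
move=> A0 C0 iA iC.
have AC : A != ~: A.
  by apply: contraNneq A0 => eqA; rewrite -[A]setIid {2}eqA setICr.
split; last by rewrite cards2 AC.
apply/andP; split; last by apply/forall_inP => X /set2P[]->.
apply/and3P; split; last by rewrite !inE negb_or !(eq_sym set0) A0.
  by rewrite /cover bigcup_setU !big_set1 setUCr.
apply/trivIsetP => X Y /set2P[]-> /set2P[]->; rewrite ?eqxx // => _.
  by rewrite -setI_eq0 setICr.
by rewrite -setI_eq0 setIC setICr.
Qed.

(** Blocks are independent, so the ends of an edge lie in different blocks. *)
Lemma imv_partition_card_gt1 (G : sgraph) (P : {set {set G}}) (x y : G) :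
  imv_partition P -> adj x y -> 1 < #|P|.
Proof.
case/andP=> /and3P[/eqP covP _ _] /forall_inP iP xy.
have inP z : exists2 X, X \in P & z \in X by apply/bigcupP; rewrite -/(cover P) covP.
have [[X XP xX] [Y YP yY]] := (inP x, inP y).
apply/card_gt1P; exists X, Y; split=> //; apply: contraTneq xy => eqXY.
by apply: (independentP _ (imv_independent (iP Y YP))); rewrite // -eqXY.
Qed.

Theorem theorem4p5 (G : sgraph) (hG : connected G) :
  chi_imv G = 2 <-> (bipartite G /\ 1 <= diam G <= 3).
Proof.
rewrite /chi_imv; case: ex_minnP => k /existsP[P /andP[partP /eqP cardP]] min_k.
split=> [k2 | [[A [iA iC]] /andP[d_gt0 /diamP d_le3]]].
  rewrite k2 in cardP.
  have [A [/set0Pn[a aA] /set0Pn[b bA]] [vA vC]] :=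
    imv_partition_setC partP cardP.
  have biA : bipartition A by rewrite /bipartition !imv_independent.
  split; first by exists A; apply/andP.
  have ab : a != b by apply: contraTneq bA => <-; rewrite inE aA.
  rewrite (diam_gt0 hG ab); apply/diamP => x y.
  have d_le2 u v : (u \in A) = (v \in A) -> gdist u v <= 2.
    move=> uv; case: (boolP (u \in A)) => uA.
      by apply: (imv_gdist_le2 biA vA uA); rewrite -uv.
    by apply: (@imv_gdist_le2 G (~: A)); rewrite ?bipartition_setC ?inE -?uv.
  have [/d_le2/leqW // | neq_xy] := eqVneq (x \in A) (y \in A).
  have xy : x != y by apply: contraNneq neq_xy => ->.
  (* Here [x] and [y] lie in opposite parts, so [z] shares the part of [y]; the edge from [x] to [z]
     adds one to a distance at most 2. *)
  have [z xz] := connected_neighbour hG xy.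
  have [p /andP[pp lp] sp] := gdist_walk (hG z y).
  apply: (@leq_trans (size (z :: p))); first by apply: gdist_min; rewrite /walk /= xz pp.
  rewrite /= sp ltnS; apply: d_le2; rewrite (bipartition_adj biA xz).
  by case: (x \in A) (y \in A) neq_xy => [] [].
have biA : bipartition A by apply/andP.
have [x [y xy]] := diam_gt0_adj hG d_gt0.
have yA := bipartition_adj biA xy.
(* The two ends of the edge witness that both parts are nonempty. *)
have [A0 C0] : A != set0 /\ ~: A != set0.
  case: (boolP (x \in A)) yA => xA yA; split; apply/set0Pn.
  - by exists x.
  - by exists y; rewrite inE yA.
  - by exists y.
  - by exists x; rewrite inE.
have vA : imv A by apply: bipartition_imv => // u v _ _.
have vC : imv (~: A).
  by apply: bipartition_imv; rewrite ?bipartition_setC // => u v _ _.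
have [partQ cardQ] := imv_setC_partition A0 C0 vA vC.
(* The edge gives [2 <= k] for the optimal partition [P]; minimality of [k] against the two parts
   gives [k <= 2]. *)
apply/eqP; rewrite eqn_leq -{2}cardP (imv_partition_card_gt1 partP xy).
by rewrite min_k //; apply/existsP; exists [set A; ~: A]; rewrite partQ cardQ /=.
Qed.
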